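(* Let $r(s)$, $L_1\le s\le L_2$, be a regular curve in $\mathbb{R}^3$ parametrized by arc length $s$, with curvature $\kappa$ and torsion $\tau$, and let $\{T,U,V\}$ be a rotation minimizing frame along $r$, with $\theta=\theta(s)$ the angle between the principal normal $N$ and $U$. Let $a,b,c$ be $C^1$ functions on $[L_1,L_2]\times[T_1,T_2]$ and let $$P(s,t)=r(s)+a(s,t)T(s)+b(s,t)U(s)+c(s,t)V(s),\qquad L_1\le s\le L_2,\ T_1\le t\le T_2,$$ and let $t_0\in[T_1,T_2]$. The necessary and sufficient condition for the curve $r(s)$ to be both isoparametric (as the parameter curve $t=t_0$) and asymptotic on the surface $P(s,t)$ is that, for all $s\in[L_1,L_2]$, $$\begin{cases} a(s,t_0)=b(s,t_0)=c(s,t_0)= 0,\\[2pt] \kappa(s)\cos\theta(s)\,\dfrac{\partial c}{\partial t}(s,t_0)=-\kappa(s)\sin\theta(s)\,\dfrac{\partial b}{\partial t}(s,t_0),\\[4pt] \theta'(s)=-\tau(s).\end{cases}$$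
   Context: The Frenet frame, defined where $r''\neq0$, is $T=r'$, $N=r''/\|r''\|$, $B=T\times N$, with $T'=\kappa N$, $N'=-\kappa T+\tau B$, $B'=-\tau N$. A rotation minimizing frame along $r$ is an orthonormal frame $\{T,U,V\}$ with $T=r'$ and $U'=-(U\cdot r'')r'$, $V'=-(V\cdot r'')r'$ (equivalently, $U'$ and $V'$ are parallel to $T$); it is defined along $r$ even where the curvature vanishes. Where the Frenet frame is defined, the angle $\theta$ is given by $U=\cos\theta\,N+\sin\theta\,B$, $V=-\sin\theta\,N+\cos\theta\,B$. The curve $r$ is isoparametric on $P$ (as the parameter curve $t=t_0$) if $P(s,t_0)=r(s)$ for all $s$. A curve on a surface is asymptotic if its velocity is always a direction of zero normal curvature; for $r(s)=P(s,t_0)$ this is expressed as $\frac{\partial n}{\partial s}(s,t_0)\cdot T(s)=0$ for all $s$, where $n(s,t)=\frac{\partial P}{\partial s}\times\frac{\partial P}{\partial t}$ is the surface normal. *)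

(* Defs.v *)
From Stdlib Require Import Reals Lra.
From Coquelicot Require Import Coquelicot.
Open Scope R_scope.

Definition R3 : Type := (R * R * R)%type.
Definition v1 (u : R3) : R := fst (fst u).
Definition v2 (u : R3) : R := snd (fst u).
Definition v3 (u : R3) : R := snd u.

Definition vzero : R3 := (0, 0, 0).
Definition vadd (u v : R3) : R3 := (v1 u + v1 v, v2 u + v2 v, v3 u + v3 v).
Definition vscal (k : R) (u : R3) : R3 := (k * v1 u, k * v2 u, k * v3 u).
Definition dot (u v : R3) : R := v1 u * v1 v + v2 u * v2 v + v3 u * v3 v.
Definition vnorm (u : R3) : R := sqrt (dot u u).
Definition cross (u v : R3) : R3 :=
  (v2 u * v3 v - v3 u * v2 v,
   v3 u * v1 v - v1 u * v3 v,
   v1 u * v2 v - v2 u * v1 v).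

Definition Icc (a b : R) : R -> Prop := fun x => a <= x <= b.

(* [D_in] is the derivative relative to a set, hence one-sided at the
   endpoints of a closed interval.  [Derive_in] is the associated total
   operator, meaningful where the derivative exists. *)
Definition is_derive_in (D : R -> Prop) (f : R -> R) (x l : R) : Prop :=
  D_in f (fun _ => l) D x.
Definition ex_derive_in (D : R -> Prop) (f : R -> R) (x : R) : Prop :=
  exists l, is_derive_in D f x l.
Definition Derive_in (D : R -> Prop) (f : R -> R) (x : R) : R :=
  iota (fun l => is_derive_in D f x l).

Definition is_vderive_in (D : R -> Prop) (f : R -> R3) (x : R) (l : R3) : Prop :=
  is_derive_in D (fun y => v1 (f y)) x (v1 l) /\
  is_derive_in D (fun y => v2 (f y)) x (v2 l) /\
  is_derive_in D (fun y => v3 (f y)) x (v3 l).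
Definition ex_vderive_in (D : R -> Prop) (f : R -> R3) (x : R) : Prop :=
  exists l, is_vderive_in D f x l.
Definition vDerive_in (D : R -> Prop) (f : R -> R3) (x : R) : R3 :=
  (Derive_in D (fun y => v1 (f y)) x,
   Derive_in D (fun y => v2 (f y)) x,
   Derive_in D (fun y => v3 (f y)) x).

Definition C1_on_rectangle (L1 L2 T1 T2 : R) (f : R -> R -> R) : Prop :=
  let rect (p : R * R) := Icc L1 L2 (fst p) /\ Icc T1 T2 (snd p) in
  (forall s t, Icc L1 L2 s -> Icc T1 T2 t ->
     ex_derive_in (Icc L1 L2) (fun s' => f s' t) s /\
     ex_derive_in (Icc T1 T2) (f s) t) /\
  continuous_on rect
    (fun p => Derive_in (Icc L1 L2) (fun s' => f s' (snd p)) (fst p)) /\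
  continuous_on rect
    (fun p => Derive_in (Icc T1 T2) (f (fst p)) (snd p)).

Section Curve.
Variables (I : R -> Prop) (r : R -> R3).

Definition velocity : R -> R3 := vDerive_in I r.
Definition acceleration : R -> R3 := vDerive_in I velocity.

(* Three derivatives: the regularity needed for the torsion to exist
   wherever the acceleration does not vanish. *)
Definition arc_length_curve : Prop :=
  forall s, I s ->
    ex_vderive_in I r s /\ ex_vderive_in I velocity s /\
    ex_vderive_in I acceleration s /\ vnorm (velocity s) = 1.

Definition frenet_defined (s : R) : Prop := acceleration s <> vzero.

Definition frenet_N (s : R) : R3 :=
  vscal (/ vnorm (acceleration s)) (acceleration s).
Definition frenet_B (s : R) : R3 := cross (velocity s) (frenet_N s).
Definition curvature (s : R) : R := vnorm (acceleration s).
(* The coefficient in [B' = - torsion * N]. *)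
Definition torsion (s : R) : R := - dot (vDerive_in I frenet_B s) (frenet_N s).

Definition rotation_minimizing_frame (U V : R -> R3) : Prop :=
  forall s, I s ->
    dot (U s) (U s) = 1 /\ dot (V s) (V s) = 1 /\ dot (U s) (V s) = 0 /\
    dot (velocity s) (U s) = 0 /\ dot (velocity s) (V s) = 0 /\
    is_vderive_in I U s (vscal (- dot (U s) (acceleration s)) (velocity s)) /\
    is_vderive_in I V s (vscal (- dot (V s) (acceleration s)) (velocity s)).

(* The angle exists only where the Frenet frame does.  Continuity fixes a
   branch of it on each arc; its differentiability is not assumed. *)
Definition frame_angle (U V : R -> R3) (theta : R -> R) : Prop :=
  continuous_on (fun s => I s /\ frenet_defined s) theta /\
  forall s, I s -> frenet_defined s ->
    U s = vadd (vscal (cos (theta s)) (frenet_N s))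
               (vscal (sin (theta s)) (frenet_B s)) /\
    V s = vadd (vscal (- sin (theta s)) (frenet_N s))
               (vscal (cos (theta s)) (frenet_B s)).

Definition frame_surface (U V : R -> R3) (a b c : R -> R -> R)
    (s t : R) : R3 :=
  vadd (r s) (vadd (vscal (a s t) (velocity s))
                   (vadd (vscal (b s t) (U s)) (vscal (c s t) (V s)))).

Variables (J : R -> Prop) (P : R -> R -> R3).

Definition surface_normal (s t : R) : R3 :=
  cross (vDerive_in I (fun s' => P s' t) s) (vDerive_in J (P s) t).

Definition isoparametric (t0 : R) : Prop := forall s, I s -> P s t0 = r s.

(* [(dn/ds)(s,t0) . T(s) = 0], where the [T(s)]-component of [dn/ds] is the
   derivative at [s] of the [T(s)]-component of [n], with [T(s)] held fixed.
   For a C^1 surface the vector [dn/ds] itself may fail to exist; when it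
   does exist, this is literally [dot dn (T s) = 0]: see
   [asymptotic_dn_ds] below. *)
Definition asymptotic (t0 : R) : Prop :=
  forall s, I s ->
    is_derive_in I (fun s' => dot (surface_normal s' t0) (velocity s)) s 0.

End Curve.

Lemma Icc_adherent (a b x : R) : a < b -> Icc a b x ->
  adhDa (D_x (Icc a b) x) x.
Proof.
intros Hab [Hx1 Hx2] eps Heps.
destruct (Rlt_le_dec x b) as [H | H].
- exists (Rmin b (x + eps / 2)).
  unfold D_x, Icc, Rdist, Rmin; destruct (Rle_dec b (x + eps / 2));
    repeat split; try lra; rewrite Rabs_right; lra.
- exists (Rmax a (x - eps / 2)).
  unfold D_x, Icc, Rdist, Rmax; destruct (Rle_dec a (x - eps / 2));
    repeat split; try lra; rewrite Rabs_left1; lra.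
Qed.

Lemma is_derive_in_unique (a b : R) (f : R -> R) (x l1 l2 : R) :
  a < b -> Icc a b x ->
  is_derive_in (Icc a b) f x l1 -> is_derive_in (Icc a b) f x l2 -> l1 = l2.
Proof.
intros Hab Hx H1 H2.
exact (single_limit _ _ _ _ _ (Icc_adherent a b x Hab Hx) H1 H2).
Qed.

Lemma Derive_in_unique (a b : R) (f : R -> R) (x l : R) :
  a < b -> Icc a b x ->
  is_derive_in (Icc a b) f x l -> Derive_in (Icc a b) f x = l.
Proof.
intros Hab Hx H.
apply (@iota_unique R_AbsRing R_CompleteNormedModule); [| exact H].
intros y Hy; exact (is_derive_in_unique a b f x y l Hab Hx Hy H).
Qed.

Lemma is_derive_in_dot (D : R -> Prop) (n : R -> R3) (x : R) (dn v : R3) :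
  is_vderive_in D n x dn -> is_derive_in D (fun y => dot (n y) v) x (dot dn v).
Proof.
intros [H1 [H2 H3]].
assert (K : forall (f : R -> R) (l k : R),
  is_derive_in D f x l -> is_derive_in D (fun y => f y * k) x (l * k)).
{ intros f l k Hf.
  assert (E := Dmult D (fun _ => l) (fun _ => 0) f (fun _ => k) x Hf
                 (Dconst D k x)).
  unfold is_derive_in, D_in in *.
  replace (l * k) with (l * k + f x * 0) by ring; exact E. }
unfold dot.
exact (Dadd D (fun _ => v1 dn * v1 v + v2 dn * v2 v) (fun _ => v3 dn * v3 v)
  (fun y => v1 (n y) * v1 v + v2 (n y) * v2 v) (fun y => v3 (n y) * v3 v) x
  (Dadd D (fun _ => v1 dn * v1 v) (fun _ => v2 dn * v2 v)
    (fun y => v1 (n y) * v1 v) (fun y => v2 (n y) * v2 v) x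
    (K _ _ _ H1) (K _ _ _ H2)) (K _ _ _ H3)).
Qed.

Lemma asymptotic_dn_ds (L1 L2 : R) (r : R -> R3) (J : R -> Prop)
    (P : R -> R -> R3) (t0 : R) (dn : R -> R3) :
  L1 < L2 ->
  (forall s, Icc L1 L2 s ->
     is_vderive_in (Icc L1 L2)
       (fun s' => surface_normal (Icc L1 L2) J P s' t0) s (dn s)) ->
  asymptotic (Icc L1 L2) r J P t0 <->
  (forall s, Icc L1 L2 s -> dot (dn s) (velocity (Icc L1 L2) r s) = 0).
Proof.
intros HL Hn; split; intros H s Hs.
- exact (is_derive_in_unique L1 L2 _ s _ _ HL Hs
    (is_derive_in_dot _ _ s _ _ (Hn s Hs)) (H s Hs)).
- rewrite <- (H s Hs); exact (is_derive_in_dot _ _ s _ _ (Hn s Hs)).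
Qed.

(* Main.v *)
(* Since r(s) = P(s,t0), the normal along t = t0 is b_t T x U + c_t T x V.  Both
   products are orthogonal to T, so only their own derivatives contribute to
   (dn/ds).T, which equals b_t (r'' x U).T + c_t (r'' x V).T, that is,
   kappa (b_t sin theta + c_t cos theta): the second condition.  The third,
   theta' = - tau, holds for every rotation minimizing frame. *)

Require Import Defs.
From Stdlib Require Import Reals Lra.
From Coquelicot Require Import Coquelicot.
Open Scope R_scope.

(** * Calculus of real functions relative to a set *)

(** Locality matters because the Frenet identities hold only where the acceleration is nonzero,
    hence only near a given point. Membership [D x] is what makes [f] and [g] agree at [x] itself, a
    value that enters every difference quotient. *)
Lemma is_derive_in_ext_loc (D : R -> Prop) (f g : R -> R) (x l : R) :
  D x ->
  (exists d, 0 < d /\ forall y, D y -> Rabs (y - x) < d -> f y = g y) ->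
  is_derive_in D f x l -> is_derive_in D g x l.
Proof.
intros Dx [d [Hd E]] H eps Heps.
destruct (H eps Heps) as [alp [Halp K]].
exists (Rmin d alp); split; [now apply Rmin_pos |].
intros y [[Dy Hy] Hdist].
simpl in *; unfold Rdist in Hdist.
rewrite <- (E y), <- (E x); trivial.
- apply K; split; [now split |].
  eapply Rlt_le_trans; [exact Hdist | apply Rmin_r].
- now rewrite Rminus_diag, Rabs_R0.
- eapply Rlt_le_trans; [exact Hdist | apply Rmin_l].
Qed.

Lemma is_derive_in_ext (D : R -> Prop) (f g : R -> R) (x l : R) :
  D x -> (forall y, D y -> f y = g y) ->
  is_derive_in D f x l -> is_derive_in D g x l.
Proof.
intros Dx E; apply is_derive_in_ext_loc; [exact Dx |].
exists 1; split; [lra | now intros y Dy _; apply E].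
Qed.

Lemma is_derive_in_const (D : R -> Prop) (k x : R) :
  is_derive_in D (fun _ => k) x 0.
Proof. exact (Dconst D k x). Qed.

Lemma is_derive_in_plus (D : R -> Prop) (f g : R -> R) (x df dg : R) :
  is_derive_in D f x df -> is_derive_in D g x dg ->
  is_derive_in D (fun y => f y + g y) x (df + dg).
Proof. exact (Dadd D (fun _ => df) (fun _ => dg) f g x). Qed.

Lemma is_derive_in_minus (D : R -> Prop) (f g : R -> R) (x df dg : R) :
  is_derive_in D f x df -> is_derive_in D g x dg ->
  is_derive_in D (fun y => f y - g y) x (df - dg).
Proof. exact (Dminus D (fun _ => df) (fun _ => dg) f g x). Qed.

Lemma is_derive_in_mult (D : R -> Prop) (f g : R -> R) (x df dg : R) :
  is_derive_in D f x df -> is_derive_in D g x dg ->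
  is_derive_in D (fun y => f y * g y) x (df * g x + f x * dg).
Proof. exact (Dmult D (fun _ => df) (fun _ => dg) f g x). Qed.

Lemma is_derive_in_comp (D : R -> Prop) (f g : R -> R) (x df dg : R) :
  is_derive_in D f x df -> derivable_pt_lim g (f x) dg ->
  is_derive_in D (fun y => g (f y)) x (df * dg).
Proof.
intros Hf Hg.
apply (derivable_pt_lim_D_in g (fun _ => dg)) in Hg.
intros eps Heps.
(* [Dcomp] differentiates relative to the points of [D] that [f] sends into the domain of [g]. That
   domain is the whole line here, so the unpacking only discharges a trivial condition. *)
destruct (Dcomp _ _ _ _ f g x Hf Hg eps Heps) as [alp [Halp K]].
exists alp; split; [exact Halp |].
intros y [[Dy Hy] Hdist]; apply K; now repeat split.
Qed.

Lemma is_derive_in_continuous (D : R -> Prop) (f : R -> R) (x l eps : R) :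
  is_derive_in D f x l -> 0 < eps ->
  exists d, 0 < d /\
    forall y, D y -> Rabs (y - x) < d -> Rabs (f y - f x) < eps.
Proof.
intros H Heps.
destruct (cont_deriv f (fun _ => l) D x H eps Heps) as [d [Hd K]].
exists d; split; [exact Hd |]; intros y Dy Hy.
(* [cont_deriv] gives a limit over the punctured set, so [y = x] is treated apart. *)
destruct (Req_dec y x) as [-> | Hne].
- now rewrite Rminus_diag, Rabs_R0.
- apply K; now repeat split.
Qed.

(* Only continuity of [f] is required, because [g] vanishes at [x]. *)
Lemma is_derive_in_mult_zero (D : R -> Prop) (f g : R -> R) (x dg : R) :
  limit1_in f D (f x) x -> g x = 0 -> is_derive_in D g x dg ->
  is_derive_in D (fun y => f y * g y) x (f x * dg).
Proof.
intros Hf g0 Hg.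
assert (Hf' : limit1_in f (D_x D x) (f x) x).
{ intros eps Heps; destruct (Hf eps Heps) as [d [Hd K]].
  exists d; split; [exact Hd |]; intros y [[Dy _] Hy]; apply K; now split. }
pose proof (limit_mul _ _ _ _ _ _ Hf' Hg) as H.
intros eps Heps; destruct (H eps Heps) as [d [Hd K]].
exists d; split; [exact Hd |]; intros y Hy.
replace ((f y * g y - f x * g x) / (y - x))
  with (f y * ((g y - g x) / (y - x)))
  by (rewrite g0; unfold Rdiv; ring).
now apply K.
Qed.

(* Near [x], [theta - theta x] is the arcsine of
   [sin theta * cos (theta x) - cos theta * sin (theta x)]. *)
Lemma is_derive_in_angle (D : R -> Prop) (theta : R -> R) (x dc ds : R) :
  D x -> limit1_in theta D (theta x) x ->
  is_derive_in D (fun y => cos (theta y)) x dc ->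
  is_derive_in D (fun y => sin (theta y)) x ds ->
  is_derive_in D theta x (ds * cos (theta x) - dc * sin (theta x)).
Proof.
intros Dx Hcont Hc Hs.
set (f := fun y => sin (theta y - theta x)).
assert (fx : f x = 0) by (unfold f; now rewrite Rminus_diag, sin_0).
assert (Hf : is_derive_in D f x (ds * cos (theta x) - dc * sin (theta x))).
{ apply is_derive_in_ext with
    (f := fun y => sin (theta y) * cos (theta x) - cos (theta y) * sin (theta x)).
  - exact Dx.
  - intros y _; unfold f; now rewrite sin_minus.
  - replace (ds * cos (theta x) - dc * sin (theta x)) with
      ((ds * cos (theta x) + sin (theta x) * 0)
       - (dc * sin (theta x) + cos (theta x) * 0)) by ring.
    exact (is_derive_in_minus _ _ _ _ _ _
      (is_derive_in_mult _ _ _ _ _ _ Hs (is_derive_in_const D _ x))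
      (is_derive_in_mult _ _ _ _ _ _ Hc (is_derive_in_const D _ x))). }
assert (Hasin : derivable_pt_lim asin (f x) 1).
{ rewrite fx.
  assert (H0 : -1 < 0 < 1) by lra.
  apply derive_pt_eq_1 with (pr := derivable_pt_asin 0 H0).
  rewrite derive_pt_asin; unfold Rsqr.
  replace (1 - 0 * 0) with 1 by ring; rewrite sqrt_1; field. }
pose proof (is_derive_in_comp _ _ _ _ _ _ Hf Hasin) as H.
apply is_derive_in_ext_loc
  with (f := fun y => asin (f y) + theta x); [exact Dx | |].
(* [asin] inverts [sin] only on [[-PI/2, PI/2]]; continuity of [theta] keeps [theta y - theta x] in
   that range for [y] near [x]. *)
- destruct (Hcont (PI / 2)) as [d [Hd K]]; [pose proof PI_RGT_0; lra |].
  exists d; split; [exact Hd |]; intros y Dy Hy.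
  assert (B : Rabs (theta y - theta x) < PI / 2) by (apply K; now split).
  apply Rabs_def2 in B.
  unfold f; rewrite asin_sin; lra.
- replace (ds * cos (theta x) - dc * sin (theta x)) with
    ((ds * cos (theta x) - dc * sin (theta x)) * 1 + 0) by ring.
  apply is_derive_in_plus; [exact H | apply is_derive_in_const].
Qed.

(** * Calculus of vector-valued functions *)

Lemma is_vderive_in_ext (D : R -> Prop) (f g : R -> R3) (x : R) (l : R3) :
  D x -> (forall y, D y -> f y = g y) ->
  is_vderive_in D f x l -> is_vderive_in D g x l.
Proof.
intros Dx E [H1 [H2 H3]].
repeat split; (eapply is_derive_in_ext;
  [exact Dx | | first [exact H1 | exact H2 | exact H3]]);
  intros y Dy; simpl; now rewrite (E y Dy).
Qed.

Lemma is_vderive_in_const (D : R -> Prop) (k : R3) (x : R) :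
  is_vderive_in D (fun _ => k) x vzero.
Proof. repeat split; apply is_derive_in_const. Qed.

Lemma is_vderive_in_add (D : R -> Prop) (f g : R -> R3) (x : R) (df dg : R3) :
  is_vderive_in D f x df -> is_vderive_in D g x dg ->
  is_vderive_in D (fun y => vadd (f y) (g y)) x (vadd df dg).
Proof.
intros [F1 [F2 F3]] [G1 [G2 G3]].
repeat split; now apply is_derive_in_plus.
Qed.

Lemma is_vderive_in_scal (D : R -> Prop) (k : R -> R) (f : R -> R3) (x dk : R)
    (df : R3) :
  is_derive_in D k x dk -> is_vderive_in D f x df ->
  is_vderive_in D (fun y => vscal (k y) (f y)) x
    (vadd (vscal dk (f x)) (vscal (k x) df)).
Proof.
intros K [F1 [F2 F3]].
repeat split; now apply is_derive_in_mult with (f := k).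
Qed.

Lemma is_vderive_in_dot (D : R -> Prop) (f g : R -> R3) (x : R) (df dg : R3) :
  is_vderive_in D f x df -> is_vderive_in D g x dg ->
  is_derive_in D (fun y => dot (f y) (g y)) x (dot df (g x) + dot (f x) dg).
Proof.
intros [F1 [F2 F3]] [G1 [G2 G3]].
pose proof (is_derive_in_mult _ _ _ _ _ _ F1 G1) as H1.
pose proof (is_derive_in_mult _ _ _ _ _ _ F2 G2) as H2.
pose proof (is_derive_in_mult _ _ _ _ _ _ F3 G3) as H3.
pose proof (is_derive_in_plus _ _ _ _ _ _
  (is_derive_in_plus _ _ _ _ _ _ H1 H2) H3) as H.
unfold dot; cbv beta in H.
match goal with |- is_derive_in _ _ _ ?l => match type of H with
  is_derive_in _ _ _ ?m => replace l with m by ring end end.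
exact H.
Qed.

Lemma is_vderive_in_cross (D : R -> Prop) (f g : R -> R3) (x : R) (df dg : R3) :
  is_vderive_in D f x df -> is_vderive_in D g x dg ->
  is_vderive_in D (fun y => cross (f y) (g y)) x
    (vadd (cross df (g x)) (cross (f x) dg)).
Proof.
intros [F1 [F2 F3]] [G1 [G2 G3]].
(* Every coordinate of a cross product has the shape [p * q - u * v]. The derivative is grouped like
   a coordinate of [vadd (cross df g) (cross f dg)], so that all three coordinates match by
   conversion. *)
assert (K : forall p q u v dp dq du dv,
  is_derive_in D p x dp -> is_derive_in D q x dq ->
  is_derive_in D u x du -> is_derive_in D v x dv ->
  is_derive_in D (fun y => p y * q y - u y * v y) x
    (dp * q x - du * v x + (p x * dq - u x * dv))).
{ intros p q u v dp dq du dv Hp Hq Hu Hv.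
  replace (dp * q x - du * v x + (p x * dq - u x * dv)) with
    (dp * q x + p x * dq - (du * v x + u x * dv)) by ring.
  apply is_derive_in_minus with (f := fun y => p y * q y);
    now apply is_derive_in_mult. }
repeat split; now apply K with
  (p := fun y => _) (q := fun y => _) (u := fun y => _) (v := fun y => _).
Qed.

Lemma vDerive_in_unique (a b : R) (f : R -> R3) (x : R) (l : R3) :
  a < b -> Icc a b x ->
  is_vderive_in (Icc a b) f x l -> vDerive_in (Icc a b) f x = l.
Proof.
intros Hab Hx [H1 [H2 H3]]; unfold vDerive_in.
rewrite (Derive_in_unique _ _ _ _ _ Hab Hx H1),
  (Derive_in_unique _ _ _ _ _ Hab Hx H2),
  (Derive_in_unique _ _ _ _ _ Hab Hx H3).
now destruct l as [[? ?] ?].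
Qed.

(** Limits at a point of a nondegenerate interval are unique, so the operator built on [iota]
    returns the derivative as soon as one exists. *)
Lemma vDerive_in_correct (a b : R) (f : R -> R3) (x : R) :
  a < b -> Icc a b x -> ex_vderive_in (Icc a b) f x ->
  is_vderive_in (Icc a b) f x (vDerive_in (Icc a b) f x).
Proof.
intros Hab Hx [l Hl]; now rewrite (vDerive_in_unique _ _ _ _ _ Hab Hx Hl).
Qed.

Lemma Derive_in_correct (a b : R) (f : R -> R) (x : R) :
  a < b -> Icc a b x -> ex_derive_in (Icc a b) f x ->
  is_derive_in (Icc a b) f x (Derive_in (Icc a b) f x).
Proof.
intros Hab Hx [l Hl]; now rewrite (Derive_in_unique _ _ _ _ _ Hab Hx Hl).
Qed.

(** * Algebra of the dot and cross products *)

Lemma dot_comm (u v : R3) : dot u v = dot v u.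
Proof. unfold dot; ring. Qed.

Lemma dot_add_r (u v w : R3) : dot u (vadd v w) = dot u v + dot u w.
Proof. unfold dot, vadd, v1, v2, v3; simpl; ring. Qed.

Lemma dot_scal_r (k : R) (u v : R3) : dot u (vscal k v) = k * dot u v.
Proof. unfold dot, vscal, v1, v2, v3; simpl; ring. Qed.

Lemma dot_add_l (u v w : R3) : dot (vadd u v) w = dot u w + dot v w.
Proof. unfold dot, vadd, v1, v2, v3; simpl; ring. Qed.

Lemma dot_scal_l (k : R) (u v : R3) : dot (vscal k u) v = k * dot u v.
Proof. unfold dot, vscal, v1, v2, v3; simpl; ring. Qed.

Lemma dot_vzero_r (u : R3) : dot u vzero = 0.
Proof. unfold dot, vzero, v1, v2, v3; simpl; ring. Qed.

Lemma dot_cross_l (u v : R3) : dot (cross u v) u = 0.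
Proof. unfold dot, cross, v1, v2, v3; simpl; ring. Qed.

Lemma dot_cross_r (u v : R3) : dot (cross u v) v = 0.
Proof. unfold dot, cross, v1, v2, v3; simpl; ring. Qed.

Lemma dot_cross_self (u v : R3) :
  dot (cross u v) (cross u v) = dot u u * dot v v - dot u v * dot u v.
Proof. unfold dot, cross, v1, v2, v3; simpl; ring. Qed.

Lemma vnorm_sqr (u : R3) : vnorm u * vnorm u = dot u u.
Proof.
apply sqrt_sqrt; unfold dot; nra.
Qed.

Lemma dot_self_gt0 (u : R3) : u <> vzero -> 0 < dot u u.
Proof.
destruct u as [[x y] z]; unfold dot, vzero, v1, v2, v3; simpl; intros H.
destruct (Req_dec x 0) as [-> |]; [| nra].
destruct (Req_dec y 0) as [-> |]; [| nra].
destruct (Req_dec z 0) as [-> |]; [| nra].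
now destruct H.
Qed.

Lemma vnorm_gt0 (u : R3) : u <> vzero -> 0 < vnorm u.
Proof. intros H; now apply sqrt_lt_R0, dot_self_gt0. Qed.

Lemma vnorm_vzero : vnorm vzero = 0.
Proof. unfold vnorm; now rewrite dot_vzero_r, sqrt_0. Qed.

(** * Continuity on a set *)

(** Bridge from the filter-based [continuous_on] to the epsilon-delta limits on which [D_in] is
    built. *)
Lemma continuous_on_limit1_in (D : R -> Prop) (f : R -> R) (x : R) :
  D x -> continuous_on D f -> limit1_in f D (f x) x.
Proof.
intros Dx H eps Heps.
destruct (proj1 (filterlim_locally _ _) (H x Dx) (mkposreal eps Heps))
  as [d K].
exists d; split; [apply cond_pos |]; intros y [Dy Hy]; now apply K.
Qed.

(** A ball of the product contains its horizontal slice through the centre. This gives the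
    continuity in [s] of the partial derivatives in [t] along [t = t0]. *)
Lemma continuous_on_rectangle_limit1_in (D E : R -> Prop) (f : R * R -> R)
    (x y : R) :
  D x -> E y -> continuous_on (fun p => D (fst p) /\ E (snd p)) f ->
  limit1_in (fun z => f (z, y)) D (f (x, y)) x.
Proof.
intros Dx Ey H eps Heps.
destruct (proj1 (filterlim_locally _ _) (H (x, y) (conj Dx Ey))
  (mkposreal eps Heps)) as [d K].
exists d; split; [apply cond_pos |]; intros z [Dz Hz].
exact (K (z, y) (conj Hz (ball_center y d)) (conj Dz Ey)).
Qed.

(** With [k] the inverse norm of [A], the second factor is [p N + q B]. The [N] part drops because
    [A x A = 0], and the [B] part is the Lagrange identity for [(A x (T x A)) . T]. The value is
    then [q] times the curvature. *)
Lemma triple_acceleration_combination (p q k : R) (A T : R3) :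
  dot T T = 1 -> dot T A = 0 ->
  dot (cross A (vadd (vscal p (vscal k A)) (vscal q (cross T (vscal k A))))) T
  = q * (k * dot A A).
Proof.
intros HT HA.
transitivity (q * k * (dot A A * dot T T - dot T A * dot T A)).
- unfold dot, cross, vadd, vscal, v1, v2, v3; simpl; ring.
- rewrite HT, HA; ring.
Qed.

(** * Frenet frame and frame angle of an arc-length curve *)

Section ArcLength.
Variables (L1 L2 : R) (r : R -> R3).
Hypotheses (hL : L1 < L2) (hr : arc_length_curve (Icc L1 L2) r).

Local Notation I := (Icc L1 L2).
Local Notation T := (velocity I r).
Local Notation A := (acceleration I r).

Lemma arc_length_velocity_dot (s : R) : I s -> dot (T s) (T s) = 1.
Proof.
intros Hs; destruct (hr s Hs) as (_ & _ & _ & H).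
rewrite <- vnorm_sqr, H; ring.
Qed.

Lemma arc_length_velocity_derive (s : R) : I s -> is_vderive_in I T s (A s).
Proof. intros Hs; now apply vDerive_in_correct, hr. Qed.

(** Differentiating the constant [T . T = 1] gives [2 (T . A) = 0]. *)
Lemma dot_velocity_acceleration (s : R) : I s -> dot (T s) (A s) = 0.
Proof.
intros Hs.
pose proof (arc_length_velocity_derive s Hs) as HT.
pose proof (is_vderive_in_dot _ _ _ _ _ _ HT HT) as H.
apply (is_derive_in_ext I _ (fun _ => 1)) in H;
  [| exact Hs | exact arc_length_velocity_dot].
pose proof (is_derive_in_unique _ _ _ _ _ _ hL Hs H
  (is_derive_in_const I 1 s)) as E.
rewrite (dot_comm (A s)) in E; lra.
Qed.

(** The function [A . A] is continuous, because [A] is differentiable, and positive at [s]. Taking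
    that positive value as tolerance excludes zeros nearby. *)
Lemma frenet_defined_near (s : R) : I s -> frenet_defined I r s ->
  exists d, 0 < d /\
    forall y, I y -> Rabs (y - s) < d -> frenet_defined I r y.
Proof.
intros Hs HA.
destruct (hr s Hs) as (_ & _ & [A' HA'] & _).
destruct (is_derive_in_continuous _ _ _ _ _
  (is_vderive_in_dot _ _ _ _ _ _ HA' HA') (dot_self_gt0 _ HA))
  as [d [Hd K]].
exists d; split; [exact Hd |]; intros y Hy Hys E.
specialize (K y Hy Hys); apply Rabs_def2 in K.
rewrite E, dot_vzero_r in K; lra.
Qed.

(** The third derivative of the curve enters here: [N] is [A] times the inverse of [sqrt (A . A)],
    and both the root and the inverse are differentiated at a positive number. *)
Lemma frenet_N_derive (s : R) : I s -> frenet_defined I r s ->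
  ex_vderive_in I (frenet_N I r) s.
Proof.
intros Hs HA.
destruct (hr s Hs) as (_ & _ & [A' HA'] & _).
pose proof (dot_self_gt0 _ HA) as Hpos.
pose proof (is_derive_in_comp _ _ _ _ _ _
  (is_vderive_in_dot _ _ _ _ _ _ HA' HA')
  (derivable_pt_lim_sqrt _ Hpos)) as Hn.
assert (Hinv : derivable_pt_lim Rinv (vnorm (A s)) (- / (vnorm (A s))^2)).
{ apply is_derive_Reals.
  pose proof (vnorm_gt0 _ HA).
  auto_derive; [lra | field; lra]. }
eexists.
exact (is_vderive_in_scal _ _ _ _ _ _
  (is_derive_in_comp _ _ _ _ _ _ Hn Hinv) HA').
Qed.

Lemma frenet_N_unit (s : R) : frenet_defined I r s ->
  dot (frenet_N I r s) (frenet_N I r s) = 1.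
Proof.
intros HA; pose proof (vnorm_gt0 _ HA).
unfold frenet_N; rewrite dot_scal_l, dot_scal_r, <- vnorm_sqr; field; lra.
Qed.

Lemma dot_velocity_frenet_N (s : R) : I s -> dot (T s) (frenet_N I r s) = 0.
Proof.
intros Hs; unfold frenet_N.
rewrite dot_scal_r, dot_velocity_acceleration; [ring | exact Hs].
Qed.

Lemma frenet_B_unit (s : R) : I s -> frenet_defined I r s ->
  dot (frenet_B I r s) (frenet_B I r s) = 1.
Proof.
intros Hs HA; unfold frenet_B.
rewrite dot_cross_self, arc_length_velocity_dot, frenet_N_unit,
  dot_velocity_frenet_N by assumption; ring.
Qed.

(* Differentiating [cos theta = N . U] and [sin theta = B . U]: since [U'] is
   parallel to [T], only the terms [N' . U] and [B' . U] survive. *)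
Lemma frame_angle_derive (U V : R -> R3) (theta : R -> R) (s : R) :
  rotation_minimizing_frame I r U V -> frame_angle I r U V theta ->
  I s -> frenet_defined I r s -> is_derive_in I theta s (- torsion I r s).
Proof.
intros HU [Hcont Hang] Hs HA.
set (N := frenet_N I r); set (B := frenet_B I r).
destruct (frenet_N_derive s Hs HA) as [N' HN].
assert (exists B', is_vderive_in I B s B') as [B' HB].
{ eexists; exact (is_vderive_in_cross _ _ _ _ _ _
    (arc_length_velocity_derive s Hs) HN). }
destruct (HU s Hs) as (_ & _ & _ & _ & _ & HU' & _).
destruct (frenet_defined_near s Hs HA) as [d [Hd near]].
assert (BN : forall y, dot (B y) (N y) = 0) by
  (intros y; apply dot_cross_r).
assert (cosE : forall y, I y -> frenet_defined I r y ->
  dot (N y) (U y) = cos (theta y)).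
{ intros y Hy HAy; rewrite (proj1 (Hang y Hy HAy)).
  fold N B; rewrite dot_add_r, !dot_scal_r, (dot_comm (N y) (B y)), BN.
  unfold N; rewrite frenet_N_unit by assumption; ring. }
assert (sinE : forall y, I y -> frenet_defined I r y ->
  dot (B y) (U y) = sin (theta y)).
{ intros y Hy HAy; rewrite (proj1 (Hang y Hy HAy)).
  fold N B; rewrite dot_add_r, !dot_scal_r, BN.
  unfold B; rewrite frenet_B_unit by assumption; ring. }
(* A function constant where the Frenet frame exists is constant near [s], so its derivative at [s]
   is zero. Applied to [N . N], [B . B] and [B . N], this gives the three relations below. *)
assert (const : forall f k l,
  (forall y, I y -> frenet_defined I r y -> f y = k) ->
  is_derive_in I f s l -> l = 0).
{ intros f k l E H.
  apply (is_derive_in_unique _ _ (fun _ => k) s _ _ hL Hs);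
    [| apply is_derive_in_const].
  apply is_derive_in_ext_loc with (f := f); trivial.
  exists d; split; auto. }
assert (N'N : dot N' (N s) = 0).
{ pose proof (const _ 1 _ (fun y _ => frenet_N_unit y)
    (is_vderive_in_dot _ _ _ _ _ _ HN HN)) as E.
  fold N in E; rewrite (dot_comm (N s) N') in E; lra. }
assert (B'B : dot B' (B s) = 0).
{ pose proof (const _ 1 _ frenet_B_unit
    (is_vderive_in_dot _ _ _ _ _ _ HB HB)) as E.
  rewrite (dot_comm (B s) B') in E; lra. }
(* Hence [B . N' = - B' . N], which is the torsion: the derivatives of [cos theta] and [sin theta]
   involve one and the same scalar. *)
assert (B'N : dot B' (N s) + dot (B s) N' = 0).
{ exact (const _ 0 _ (fun y _ _ => BN y)
    (is_vderive_in_dot _ _ _ _ _ _ HB HN)). }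
assert (US : U s = vadd (vscal (cos (theta s)) (N s))
                        (vscal (sin (theta s)) (B s)))
  by exact (proj1 (Hang s Hs HA)).
assert (Hc : is_derive_in I (fun y => cos (theta y)) s
  (- dot B' (N s) * sin (theta s))).
{ apply is_derive_in_ext_loc with (f := fun y => dot (N y) (U y)); trivial.
  { exists d; split; auto. }
  pose proof (is_vderive_in_dot _ _ _ _ _ _ HN HU') as H.
  assert (TN : dot (T s) (N s) = 0) by now apply dot_velocity_frenet_N.
  fold N in H; rewrite dot_scal_r, (dot_comm (N s) (T s)), TN, US, dot_add_r,
    !dot_scal_r, N'N in H.
  rewrite (dot_comm N' (B s)) in H.
  match type of H with is_derive_in _ _ _ ?l =>
    replace (- dot B' (N s) * sin (theta s)) with l by
      (replace (dot (B s) N') with (- dot B' (N s)) by lra; ring) end.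
  exact H. }
assert (Hsin : is_derive_in I (fun y => sin (theta y)) s
  (dot B' (N s) * cos (theta s))).
{ apply is_derive_in_ext_loc with (f := fun y => dot (B y) (U y)); trivial.
  { exists d; split; auto. }
  pose proof (is_vderive_in_dot _ _ _ _ _ _ HB HU') as H.
  assert (BT : dot (B s) (T s) = 0) by apply dot_cross_l.
  rewrite dot_scal_r, BT, US, dot_add_r, !dot_scal_r, B'B in H.
  match type of H with is_derive_in _ _ _ ?l =>
    replace (dot B' (N s) * cos (theta s)) with l by ring end.
  exact H. }
(* Continuity of [theta] is given relative to the set where the frame exists. Within distance [d] of
   [s] this set is all of [I], so the limit holds relative to [I]. *)
assert (Hlim : limit1_in theta I (theta s) s).
{ intros eps Heps.
  destruct (continuous_on_limit1_in _ _ _ (conj Hs HA) Hcont eps Heps)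
    as [e [He K]].
  exists (Rmin d e); split; [now apply Rmin_pos |]; intros y [Hy Hys].
  apply K; split; [split; [exact Hy |] |].
  - apply near; [exact Hy |].
    eapply Rlt_le_trans; [exact Hys | apply Rmin_l].
  - eapply Rlt_le_trans; [exact Hys | apply Rmin_r]. }
pose proof (is_derive_in_angle I theta s _ _ Hs Hlim Hc Hsin) as H.
unfold torsion; fold B N; rewrite (vDerive_in_unique _ _ _ _ _ hL Hs HB).
(* The angle formula produces [B' . N] multiplied by [sin^2 + cos^2], hence the factor inserted
   here. *)
replace (- - dot B' (N s)) with
  (dot B' (N s) * (Rsqr (sin (theta s)) + Rsqr (cos (theta s))))
  by (rewrite sin2_cos2; ring).
match type of H with is_derive_in _ _ _ ?l =>
  match goal with |- is_derive_in _ _ _ ?m =>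
    replace m with l by (unfold Rsqr; ring) end end.
exact H.
Qed.

(** * The surface and its normal along [t = t0] *)

Lemma isoparametric_frame_surface (U V : R -> R3) (a b c : R -> R -> R)
    (t0 : R) :
  rotation_minimizing_frame I r U V ->
  isoparametric I r (frame_surface I r U V a b c) t0 <->
  (forall s, I s -> a s t0 = 0 /\ b s t0 = 0 /\ c s t0 = 0).
Proof.
intros HU; split; intros H s Hs.
- destruct (HU s Hs) as (UU & VV & UV & TU & TV & _).
  pose proof (arc_length_velocity_dot s Hs) as TT.
  specialize (H s Hs); unfold frame_surface in H.
  set (w := vadd (vscal (a s t0) (T s))
    (vadd (vscal (b s t0) (U s)) (vscal (c s t0) (V s)))) in H.
  (* From [r + w = r], the offset [w] is orthogonal to every vector; testing it against the
     orthonormal [T], [U], [V] isolates each coefficient. *)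
  assert (W : forall u, dot u w = 0).
  { intros u; apply (f_equal (dot u)) in H; rewrite dot_add_r in H; lra. }
  pose proof (W (T s)) as WT; pose proof (W (U s)) as WU;
    pose proof (W (V s)) as WV.
  unfold w in WT, WU, WV.
  rewrite !dot_add_r, !dot_scal_r in WT, WU, WV.
  rewrite (dot_comm (U s) (T s)) in WU.
  rewrite (dot_comm (V s) (T s)), (dot_comm (V s) (U s)) in WV.
  rewrite TT, TU, TV in WT; rewrite TU, UU, UV in WU; rewrite TV, UV, VV in WV.
  repeat split; lra.
- destruct (H s Hs) as (a0 & b0 & c0).
  unfold frame_surface; rewrite a0, b0, c0.
  unfold vadd, vscal, v1, v2, v3; destruct (r s) as [[x y] z]; simpl.
  f_equal; [f_equal |]; ring.
Qed.

(** Along [t = t0] the surface coincides with [r], so its [s]-derivative is [T]. The [t]-derivative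
    is [a_t T + b_t U + c_t V], the frame being constant in [t], and [T x T = 0] removes the [a_t]
    term. *)
Lemma frame_surface_normal (T1 T2 t0 : R) (U V : R -> R3)
    (a b c : R -> R -> R) (s : R) :
  T1 < T2 -> Icc T1 T2 t0 -> I s ->
  isoparametric I r (frame_surface I r U V a b c) t0 ->
  ex_derive_in (Icc T1 T2) (a s) t0 ->
  ex_derive_in (Icc T1 T2) (b s) t0 ->
  ex_derive_in (Icc T1 T2) (c s) t0 ->
  surface_normal I (Icc T1 T2) (frame_surface I r U V a b c) s t0 =
  vadd (vscal (Derive_in (Icc T1 T2) (b s) t0) (cross (T s) (U s)))
       (vscal (Derive_in (Icc T1 T2) (c s) t0) (cross (T s) (V s))).
Proof.
intros hT Ht Hs iso Ha Hb Hc.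
pose proof (Derive_in_correct _ _ _ _ hT Ht Ha) as Ha'.
pose proof (Derive_in_correct _ _ _ _ hT Ht Hb) as Hb'.
pose proof (Derive_in_correct _ _ _ _ hT Ht Hc) as Hc'.
pose proof (is_vderive_in_const (Icc T1 T2) (T s) t0) as KT.
pose proof (is_vderive_in_const (Icc T1 T2) (U s) t0) as KU.
pose proof (is_vderive_in_const (Icc T1 T2) (V s) t0) as KV.
pose proof (is_vderive_in_add _ _ _ _ _ _
  (is_vderive_in_const (Icc T1 T2) (r s) t0)
  (is_vderive_in_add _ _ _ _ _ _ (is_vderive_in_scal _ _ _ _ _ _ Ha' KT)
    (is_vderive_in_add _ _ _ _ _ _ (is_vderive_in_scal _ _ _ _ _ _ Hb' KU)
      (is_vderive_in_scal _ _ _ _ _ _ Hc' KV)))) as Ht'.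
unfold surface_normal.
rewrite (vDerive_in_unique _ _ (frame_surface I r U V a b c s) _ _ hT Ht Ht').
rewrite (vDerive_in_unique _ _ _ _ (T s) hL Hs).
- unfold cross, vadd, vscal, vzero, v1, v2, v3; simpl.
  f_equal; [f_equal |]; ring.
- apply is_vderive_in_ext with (f := r); trivial.
  + intros y Hy; now rewrite iso.
  + now apply vDerive_in_correct, hr.
Qed.

(* [(T x U) . T(s)] vanishes at [s], so the continuous coefficients of the
   normal need not be differentiated. *)
Lemma derive_normal_dot_velocity (U V : R -> R3) (theta p q : R -> R)
    (n : R -> R3) (s : R) :
  rotation_minimizing_frame I r U V -> frame_angle I r U V theta -> I s ->
  limit1_in p I (p s) s -> limit1_in q I (q s) s ->
  (forall y, I y ->
     n y = vadd (vscal (p y) (cross (T y) (U y)))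
                (vscal (q y) (cross (T y) (V y)))) ->
  is_derive_in I (fun y => dot (n y) (T s)) s
    (p s * (curvature I r s * sin (theta s))
     + q s * (curvature I r s * cos (theta s))).
Proof.
intros HU [_ Hang] Hs Hp Hq Hn.
destruct (HU s Hs) as (_ & _ & _ & _ & _ & HU' & HV').
pose proof (arc_length_velocity_derive s Hs) as HT.
(* Here [W] stands for [U] or [V]. Since [W'] is a multiple of [T], the term [T x W'] vanishes and
   only [A x W] contributes. *)
assert (K : forall W f k, is_vderive_in I W s (vscal k (T s)) ->
  limit1_in f I (f s) s ->
  is_derive_in I (fun y => f y * dot (cross (T y) (W y)) (T s)) s
    (f s * dot (cross (A s) (W s)) (T s))).
{ intros W f k HW Hf.
  apply is_derive_in_mult_zero
    with (g := fun y => dot (cross (T y) (W y)) (T s)); trivial.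
  { apply dot_cross_l. }
  pose proof (is_derive_in_dot _ _ _ _ (T s)
    (is_vderive_in_cross _ _ _ _ _ _ HT HW)) as H.
  match goal with |- is_derive_in _ _ _ ?l =>
    match type of H with is_derive_in _ _ _ ?m =>
      replace l with m by
        (unfold dot, cross, vadd, vscal, v1, v2, v3; simpl; ring) end end.
  exact H. }
pose proof (is_derive_in_plus _ _ _ _ _ _
  (K U p _ HU' Hp) (K V q _ HV' Hq)) as H.
apply is_derive_in_ext with (g := fun y => dot (n y) (T s)) in H; trivial.
2:{ intros y Hy; now rewrite (Hn y Hy), dot_add_l, !dot_scal_l. }
match goal with |- is_derive_in _ _ _ ?l =>
  match type of H with is_derive_in _ _ _ ?m =>
    replace l with m; [exact H |] end end.
(* Where the acceleration vanishes the angle carries no information, but then both sides are zero: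
   the curvature and each [A x W] vanish. Elsewhere [U] and [V] are expanded in [N] and [B]. *)
assert (dec : A s = vzero \/ A s <> vzero).
{ destruct (Req_dec (dot (A s) (A s)) 0) as [E | E].
  - left; destruct (A s) as [[x y] z]; unfold dot, v1, v2, v3 in E;
      simpl in E; unfold vzero; f_equal; [f_equal |]; nra.
  - right; intros E'; now rewrite E', dot_vzero_r in E. }
destruct dec as [E | HA].
- unfold curvature; rewrite E, vnorm_vzero.
  unfold dot, cross, vzero, v1, v2, v3; simpl; ring.
- destruct (Hang s Hs HA) as [-> ->].
  unfold frenet_B, frenet_N, curvature.
  pose proof (vnorm_gt0 _ HA).
  rewrite !triple_acceleration_combination, <- vnorm_sqr
    by auto using arc_length_velocity_dot, dot_velocity_acceleration.
  field; lra.
Qed.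

End ArcLength.

Theorem theorem3p3 (L1 L2 T1 T2 t0 : R) (r U V : R -> R3) (theta : R -> R)
    (a b c : R -> R -> R)
    (hL : L1 < L2) (hT : T1 < T2) (ht0 : Icc T1 T2 t0)
    (hr : arc_length_curve (Icc L1 L2) r)
    (hUV : rotation_minimizing_frame (Icc L1 L2) r U V)
    (htheta : frame_angle (Icc L1 L2) r U V theta)
    (ha : C1_on_rectangle L1 L2 T1 T2 a)
    (hb : C1_on_rectangle L1 L2 T1 T2 b)
    (hc : C1_on_rectangle L1 L2 T1 T2 c) :
  let I := Icc L1 L2 in
  let J := Icc T1 T2 in
  let kappa := curvature I r in
  let tau := torsion I r in
  let P := frame_surface I r U V a b c in
  (isoparametric I r P t0 /\ asymptotic I r J P t0) <->
  (forall s, I s ->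
     (a s t0 = 0 /\ b s t0 = 0 /\ c s t0 = 0) /\
     kappa s * cos (theta s) * Derive_in J (c s) t0 =
       - (kappa s * sin (theta s) * Derive_in J (b s) t0) /\
     (frenet_defined I r s -> is_derive_in I theta s (- tau s))).
Proof.
intros I J kappa tau P.
pose proof (isoparametric_frame_surface L1 L2 r hr U V a b c t0 hUV) as Iso.
fold I P in Iso.
assert (lim : forall f, C1_on_rectangle L1 L2 T1 T2 f -> forall s, I s ->
  limit1_in (fun y => Derive_in J (f y) t0) I (Derive_in J (f s) t0) s).
{ intros f (_ & _ & Hf) s Hs.
  exact (continuous_on_rectangle_limit1_in _ _ _ _ _ Hs ht0 Hf). }
(* This derivative serves both directions. If the curve is asymptotic, uniqueness equates it with
   zero, which is the second condition; conversely that condition makes it zero. *)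
assert (dn : isoparametric I r P t0 -> forall s, I s ->
  is_derive_in I (fun y => dot (surface_normal I J P y t0) (velocity I r s)) s
    (Derive_in J (b s) t0 * (kappa s * sin (theta s))
     + Derive_in J (c s) t0 * (kappa s * cos (theta s)))).
{ intros iso s Hs.
  apply (derive_normal_dot_velocity L1 L2 r hL hr U V theta
    (fun y => Derive_in J (b y) t0) (fun y => Derive_in J (c y) t0)); auto.
  intros y Hy; apply frame_surface_normal; trivial.
  - now apply ha.
  - now apply hb.
  - now apply hc. }
split.
- intros [iso asym] s Hs; split; [| split].
  + exact (proj1 Iso iso s Hs).
  + pose proof (is_derive_in_unique _ _ _ _ _ _ hL Hs
      (dn iso s Hs) (asym s Hs)); lra.
  + exact (frame_angle_derive L1 L2 r hL hr U V theta s hUV htheta Hs).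
- intros H.
  assert (iso : isoparametric I r P t0).
  { apply Iso; intros s Hs; now apply H. }
  split; [exact iso |]; intros s Hs.
  replace 0 with (Derive_in J (b s) t0 * (kappa s * sin (theta s))
     + Derive_in J (c s) t0 * (kappa s * cos (theta s))).
  + exact (dn iso s Hs).
  + destruct (H s Hs) as (_ & E & _); lra.
Qed.
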